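(* Let $-\infty<a<b<\infty$, $n\in\mathbb{N}$, $n-1<\alpha<n$, $0\le\beta\le1$, and let $\psi\in C^n[a,b]$ be real-valued and increasing with $\psi'(x)\neq0$ for all $x\in[a,b]$. Given $\delta\in\mathbb{R}$ with $\delta>n$, consider the functions $f(x)=(\psi(x)-\psi(a))^{\delta-1}$ and $g(x)=(\psi(b)-\psi(x))^{\delta-1}$. Then $$ {}^{H}\mathbb{D}_{a+}^{\alpha,\beta;\psi}f(x)=\frac{\Gamma(\delta)}{\Gamma(\delta-\alpha)}(\psi(x)-\psi(a))^{\delta-\alpha-1} $$ and $$ {}^{H}\mathbb{D}_{b-}^{\alpha,\beta;\psi}g(x)=\frac{\Gamma(\delta)}{\Gamma(\delta-\alpha)}(\psi(b)-\psi(x))^{\delta-\alpha-1}. $$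
   Context: For $\mu>0$: $I_{a+}^{\mu;\psi}h(x)=\frac{1}{\Gamma(\mu)}\int_a^x\psi'(t)(\psi(x)-\psi(t))^{\mu-1}h(t)\,dt$ and $I_{b-}^{\mu;\psi}h(x)=\frac{1}{\Gamma(\mu)}\int_x^b\psi'(t)(\psi(t)-\psi(x))^{\mu-1}h(t)\,dt$; for $\mu=0$ these are the identity. The $\psi$-Hilfer fractional derivatives of order $\alpha$ and type $\beta$ are ${}^{H}\mathbb{D}_{a+}^{\alpha,\beta;\psi}h=I_{a+}^{\beta(n-\alpha);\psi}\left(\frac{1}{\psi'}\frac{d}{dx}\right)^nI_{a+}^{(1-\beta)(n-\alpha);\psi}h$ (for $x\in(a,b]$) and ${}^{H}\mathbb{D}_{b-}^{\alpha,\beta;\psi}h=I_{b-}^{\beta(n-\alpha);\psi}\left(-\frac{1}{\psi'}\frac{d}{dx}\right)^nI_{b-}^{(1-\beta)(n-\alpha);\psi}h$ (for $x\in[a,b)$). *)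

(* Defs.v *)
From HB Require Import structures.
From mathcomp Require Export all_boot all_order all_algebra.
From mathcomp Require Export all_classical all_reals all_analysis.
Export Order.TTheory GRing.Theory Num.Theory numFieldNormedType.Exports.

Set Implicit Arguments.
Unset Strict Implicit.
Unset Printing Implicit Defensive.

Local Open Scope classical_set_scope.
Local Open Scope ring_scope.

Definition diff_quotient (R : realType) (h : R -> R) (x : R) : R -> R :=
  fun y => (h y - h x) / (y - x).

(* Derivative relative to a set A: on A = `[a, b] it is the ordinary derivative
   at interior points and the one-sided derivative at a and b, so it does not
   depend on the values of h outside A. *)
Definition derivable_within (R : realType) (A : set R) (h : R -> R) (x : R) :=
  cvg (diff_quotient h x @ within A x^').

Definition derive_within (R : realType) (A : set R) (h : R -> R) (x : R) : R :=
  lim (diff_quotient h x @ within A x^').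

Definition Cn_within (R : realType) (A : set R) (n : nat) (h : R -> R) :=
  (forall k x, (k < n)%N -> A x ->
     derivable_within A (iter k (derive_within A) h) x) /\
  (forall k, (k <= n)%N ->
     {within A, continuous (iter k (derive_within A) h)}).

(* Euler's integral; this is the Gamma function for z > 0 only. *)
Definition Gamma (R : realType) (z : R) : R :=
  \int[lebesgue_measure]_(t in `]0, +oo[%classic) (t `^ (z - 1) * expR (- t)).

Definition fracint_left_kernel (R : realType) (a b mu : R) (psi h : R -> R)
    (x t : R) : R :=
  derive_within `[a, b]%classic psi t * (psi x - psi t) `^ (mu - 1) * h t.

Definition fracint_right_kernel (R : realType) (a b mu : R) (psi h : R -> R)
    (x t : R) : R :=
  derive_within `[a, b]%classic psi t * (psi t - psi x) `^ (mu - 1) * h t.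

(* psi and h live on [a, b], hence both end points are parameters. *)
Definition fracint_left (R : realType) (a b mu : R) (psi h : R -> R) (x : R) :=
  if mu == 0 then h x else
  (Gamma mu)^-1 * \int[lebesgue_measure]_(t in `[a, x]%classic)
                     fracint_left_kernel a b mu psi h x t.

Definition fracint_right (R : realType) (a b mu : R) (psi h : R -> R) (x : R) :=
  if mu == 0 then h x else
  (Gamma mu)^-1 * \int[lebesgue_measure]_(t in `[x, b]%classic)
                     fracint_right_kernel a b mu psi h x t.

Definition fracint_left_exists (R : realType) (a b mu : R) (psi h : R -> R)
    (x : R) :=
  mu != 0 -> (@lebesgue_measure R).-integrable `[a, x]%classic
               (EFin \o fracint_left_kernel a b mu psi h x).

Definition fracint_right_exists (R : realType) (a b mu : R) (psi h : R -> R)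
    (x : R) :=
  mu != 0 -> (@lebesgue_measure R).-integrable `[x, b]%classic
               (EFin \o fracint_right_kernel a b mu psi h x).

Definition psi_diff_left (R : realType) (a b : R) (psi h : R -> R) : R -> R :=
  fun x => (derive_within `[a, b]%classic psi x)^-1 *
           derive_within `[a, b]%classic h x.

Definition psi_diff_right (R : realType) (a b : R) (psi h : R -> R) : R -> R :=
  fun x => - (derive_within `[a, b]%classic psi x)^-1 *
           derive_within `[a, b]%classic h x.

Definition hilfer_left (R : realType) (a b : R) (n : nat) (alpha beta : R)
    (psi h : R -> R) : R -> R :=
  fracint_left a b (beta * (n%:R - alpha)) psi
    (iter n (psi_diff_left a b psi)
       (fracint_left a b ((1 - beta) * (n%:R - alpha)) psi h)).

Definition hilfer_right (R : realType) (a b : R) (n : nat) (alpha beta : R)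
    (psi h : R -> R) : R -> R :=
  fracint_right a b (beta * (n%:R - alpha)) psi
    (iter n (psi_diff_right a b psi)
       (fracint_right a b ((1 - beta) * (n%:R - alpha)) psi h)).

(* Integrals and limits are total operators with default values, so an equation
   [hilfer_left ... x = v] is meaningful only together with the existence of
   the integrals and derivatives involved. *)
Definition hilfer_left_exists (R : realType) (a b : R) (n : nat)
    (alpha beta : R) (psi h : R -> R) (x : R) :=
  let inner := fracint_left a b ((1 - beta) * (n%:R - alpha)) psi h in
  [/\ forall y, y \in `]a, b] ->
        fracint_left_exists a b ((1 - beta) * (n%:R - alpha)) psi h y,
      forall k y, (k < n)%N -> y \in `]a, b] ->
        derivable_within `[a, b]%classic
          (iter k (psi_diff_left a b psi) inner) y
    & fracint_left_exists a b (beta * (n%:R - alpha)) psi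
        (iter n (psi_diff_left a b psi) inner) x].

Definition hilfer_right_exists (R : realType) (a b : R) (n : nat)
    (alpha beta : R) (psi h : R -> R) (x : R) :=
  let inner := fracint_right a b ((1 - beta) * (n%:R - alpha)) psi h in
  [/\ forall y, y \in `[a, b[ ->
        fracint_right_exists a b ((1 - beta) * (n%:R - alpha)) psi h y,
      forall k y, (k < n)%N -> y \in `[a, b[ ->
        derivable_within `[a, b]%classic
          (iter k (psi_diff_right a b psi) inner) y
    & fracint_right_exists a b (beta * (n%:R - alpha)) psi
        (iter n (psi_diff_right a b psi) inner) x].

(* Main.v *)
(* The Hilfer operators act on powers of phi = psi - psi a (resp. psi b - psi) as
   the classical ones act on powers of the variable: substituting u = psi t turns
   the fractional integrals into Beta integrals, so an integral of order mu sends
   phi^(p-1) to Gamma p / Gamma (p + mu) * phi^(p+mu-1), while by the chain rule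
   (1/phi') d/dx lowers the exponent of phi by one and Gamma (p+1) = p Gamma p.
   The three Gamma quotients telescope. The right-sided case needs no reflection:
   it is the same Beta integral over [x, b] with its two exponents exchanged. *)
From mathcomp Require Import ring lra measurable_realfun.
Require Import Defs.

Set Implicit Arguments.
Unset Strict Implicit.
Unset Printing Implicit Defensive.

Local Open Scope classical_set_scope.
Local Open Scope ring_scope.

(** * Change of variables up to singular end points *)

(** Both fractional integrals have their order in [[0, 1[], because [0 < n - alpha < 1]; so a kernel
    power of nonzero order always blows up at one end point. In the outer integral the power left by
    the [n] derivatives has exponent [delta + nu - n - 1], with [nu] the inner order; it may be
    negative too, and then both ends are singular. What helps is that all integrands are
    nonnegative: change of variables and Tonelli are carried out in [\bar R], and integrability,
    which is asserted besides the formula, is read off from the finite value. The bound [n < delta]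
    keeps the argument of every Gamma factor positive, the smallest being [delta + nu - n]; this
    matters because Euler's integral gives [Gamma] its meaning only there. The power formulas are
    available only on the half-open interval where [phi] is positive. That interval is relatively
    open in [[a, b]], so it determines the derivatives at its points, and the missing end point is a
    null set for the outer integral. *)

Section substitution.
Context {R : realType}.
Notation mu := (@lebesgue_measure R).
Implicit Types (F G : R -> R).

(* The library substitutes integrands that are continuous on a compact interval;
   exhausting by such intervals admits singularities at the end points. *)
Lemma ge0_integration_by_substitution_bigcup F G (a b : R^nat) :
  (forall n, a n <= b n) ->
  nonincreasing_seq a -> nondecreasing_seq b ->
  let D := \bigcup_n `[a n, b n]%classic in
  let E := \bigcup_n `[F (a n), F (b n)]%classic in
  (forall x y, D x -> D y -> x < y -> F x < F y) ->
  (forall x, D x -> derivable F x 1) ->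
  (forall x, D x -> {for x, continuous (derive1 F)}) ->
  (forall x, D x -> 0 <= derive1 F x) ->
  (forall y, E y -> {for y, continuous G}) ->
  (forall y, E y -> 0 <= G y) ->
  (\int[mu]_(y in E) (G y)%:E = \int[mu]_(x in D) (G (F x) * derive1 F x)%:E)%E.
Proof.
move=> ab nia ndb D E incF dF cF' F'0 cG G0.
have inD n x : x \in `[a n, b n] -> D x by exists n.
have contF x : D x -> {for x, continuous F}.
  by move=> /dF /derivable1_diffP /differentiable_continuous.
have Fab n x : x \in `[a n, b n] -> F x \in `[F (a n), F (b n)].
  move=> xab; have xn := inD _ _ xab.
  have an : D (a n) by apply: (inD n); rewrite in_itv/= lexx ab.
  have bn : D (b n) by apply: (inD n); rewrite in_itv/= lexx ab.
  have hF : forall x y, D x -> D y -> x <= y -> F x <= F y.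
    move=> u v Du Dv; rewrite le_eqVlt => /predU1P[->//|uv].
    exact/ltW/incF.
  move: xab; rewrite !in_itv/= => /andP[ax xb].
  by apply/andP; split; exact: hF.
have FDE x : D x -> E (F x) by move=> [n _ xn]; exists n => //; exact: Fab.
have mono n m : (n <= m)%N -> `[a n, b n]%classic `<=` `[a m, b m]%classic.
  move=> nm; apply: subset_itv; rewrite bnd_simp.
    exact: nia.
  exact: ndb.
have monoF n m : (n <= m)%N -> `[F (a n), F (b n)]%classic `<=` `[F (a m), F (b m)]%classic.
  move=> nm.
  have := Fab m (a n); have := Fab m (b n).
  have -> : a n \in `[a m, b m].
    by apply/(mono n m nm); rewrite /= in_itv/= lexx ab.
  have -> : b n \in `[a m, b m].
    by apply/(mono n m nm); rewrite /= in_itv/= lexx ab.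
  move=> /(_ isT); rewrite in_itv/= => /andP[_ h1].
  move=> /(_ isT); rewrite in_itv/= => /andP[h2 _].
  by apply: subset_itv; rewrite bnd_simp.
have subst n : (\int[mu]_(y in `[F (a n), F (b n)]) (G y)%:E =
   \int[mu]_(x in `[a n, b n]) (G (F x) * derive1 F x)%:E)%E.
  have an : D (a n) by apply: (inD n); rewrite in_itv/= lexx ab.
  have bn : D (b n) by apply: (inD n); rewrite in_itv/= lexx ab.
  rewrite (@integration_by_substitution_increasing _ F)//.
  - by move=> x y /inD xD /inD yD; exact: incF.
  - by move=> x /subset_itv_oo_cc /inD /cF'.
  - apply/cvg_ex; exists (derive1 F (a n)); apply: cvg_at_right_filter.
    exact: cF'.
  - apply/cvg_ex; exists (derive1 F (b n)); apply: cvg_at_left_filter.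
    exact: cF'.
  - split; first by move=> x /subset_itv_oo_cc /inD /dF.
      by apply: cvg_at_right_filter; exact: contF.
    by apply: cvg_at_left_filter; exact: contF.
  - apply: continuous_in_subspaceT => y; rewrite inE => yn.
    by apply: cG; exists n.
have mG : measurable_fun E G.
  apply/measurable_fun_bigcup => [n|n].
    exact: measurable_itv.
  apply: subspace_continuous_measurable_fun; first exact: measurable_itv.
  by apply: continuous_in_subspaceT => y; rewrite inE => yn; apply: cG; exists n.
have mGF : measurable_fun D (fun x => G (F x) * derive1 F x).
  apply/measurable_fun_bigcup => [n|n].
    exact: measurable_itv.
  apply: subspace_continuous_measurable_fun; first exact: measurable_itv.
  apply: continuous_in_subspaceT => x; rewrite inE => xn.
  have xD : D x by exists n.
  apply: continuousM; last exact: cF'.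
  by apply: continuous_comp; [exact: contF|exact/cG/FDE].
(* By [subst] both sides are limits of one and the same sequence. Monotone convergence gives the two
   limits, with [+oo] allowed as their common value. *)
have L : (\int[mu]_(y in `[F (a n), F (b n)]) (G y)%:E)%E @[n --> \oo] -->
         (\int[mu]_(y in E) (G y)%:E)%E.
  apply: ge0_nondecreasing_set_cvg_integral => //.
  - by move=> n m nm; apply/subsetPset; exact: monoF.
  - by move=> n; apply/measurable_EFinP; apply: measurable_funS mG;
      [exact: bigcup_measurable|by move=> z zn; exists n].
  - by move=> n y yn; rewrite lee_fin; apply: G0; exists n.
have L' : (\int[mu]_(x in `[a n, b n]) (G (F x) * derive1 F x)%:E)%E @[n --> \oo] -->
         (\int[mu]_(x in D) (G (F x) * derive1 F x)%:E)%E.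
  apply: ge0_nondecreasing_set_cvg_integral => //.
  - by move=> n m nm; apply/subsetPset; exact: mono.
  - by move=> n; apply/measurable_EFinP; apply: measurable_funS mGF;
      [exact: bigcup_measurable|by move=> z zn; exists n].
  - move=> n y yn; have Dy : D y by exists n.
    by rewrite lee_fin mulr_ge0//; [exact/G0/FDE|exact: F'0].
move: L; under eq_fun do rewrite subst.
by move=> /cvg_lim <- //; exact: cvg_lim L'.
Qed.

(** The shift [n.+2] starts the exhaustion at the midpoint, so that every compact interval is
    nonempty, as the hypothesis [a n <= b n] of [ge0_integration_by_substitution_bigcup] demands. *)
Lemma itvoo_bigcup (a b : R) : a < b ->
  `]a, b[%classic = \bigcup_n `[a + (b - a) * n.+2%:R^-1, b - (b - a) * n.+2%:R^-1]%classic.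
Proof.
move=> ab; have ba0 : 0 < b - a by rewrite subr_gt0.
apply/seteqP; split => [x /=|x [n _ /=]]; last first.
  have : 0 < (b - a) / n.+2%:R by rewrite divr_gt0.
  rewrite !in_itv/=; move: (_ / _) => e h /andP[h1 h2]; apply/andP; split; lra.
rewrite in_itv/= => /andP[ax xb].
have e0 : 0 < Num.min (x - a) (b - x) / (b - a).
  by rewrite divr_gt0// lt_min !subr_gt0 ax.
have [n _ /(_ n.+1)] := near_infty_natSinv_lt (PosNum e0).
rewrite /= => /(_ (leqnSn n)); rewrite ltr_pdivlMr// mulrC => h.
exists n => //=; rewrite in_itv/=; move: h; rewrite lt_min.
by move: (_ * _) => e /andP[h1 h2]; apply/andP; split; lra.
Qed.

(** Continuity up to the end points is asked of [F] alone; [derive1 F] and [G] may blow up there, as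
    powers with negative exponents do. *)
Lemma ge0_integration_by_substitution_oo F G (a b : R) : a < b ->
  {in `[a, b] &, {homo F : x y / x < y}} ->
  derivable_oo_LRcontinuous F a b ->
  {in `]a, b[, continuous (derive1 F)} ->
  {in `]a, b[, forall x, 0 <= derive1 F x} ->
  {in `]F a, F b[, continuous G} ->
  {in `]F a, F b[, forall y, 0 <= G y} ->
  (\int[mu]_(y in `]F a, F b[) (G y)%:E =
   \int[mu]_(x in `]a, b[) (G (F x) * derive1 F x)%:E)%E.
Proof.
move=> ab incF dF cF' F'0 cG G0.
have ba0 : 0 < b - a by rewrite subr_gt0.
pose u n : R := a + (b - a) * n.+2%:R^-1.
pose v n : R := b - (b - a) * n.+2%:R^-1.
have D_E := itvoo_bigcup ab.
have E_E : `]F a, F b[%classic = \bigcup_n `[F (u n), F (v n)]%classic.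
  have uv n : (u n \in `]a, b[) /\ (v n \in `]a, b[).
    have : 0 < (b - a) / n.+2%:R by rewrite divr_gt0.
    have : (b - a) / n.+2%:R < b - a.
      by rewrite ltr_pdivrMr// ltr_pMr// ltr1n.
    rewrite !in_itv/= /u /v; move: (_ / _) => e h1 h2.
    by split; apply/andP; split; lra.
  apply/seteqP; split => [y /= yab|y [n _ /=]]; last first.
    have [un vn] := uv n.
    have h1 : F a < F (u n).
      apply: incF; rewrite ?(itvP un)// ?bound_itvE ?(ltW ab)//.
      exact: subset_itv_oo_cc.
    have h2 : F (v n) < F b.
      apply: incF; rewrite ?(itvP vn)// ?bound_itvE ?(ltW ab)//.
      exact: subset_itv_oo_cc.
    by rewrite !in_itv/= => /andP[h3 h4]; apply/andP; split; lra.
  (* A preimage of [y] comes from the intermediate value theorem; the strict bounds on [y] keep it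
     off [a] and [b], hence inside one of the compact intervals. *)
  have Fab : F a < F b by apply: incF; rewrite ?bound_itvE ?(ltW ab)//.
  have [x xab Fxy] : exists2 x, x \in `[a, b] & F x = y.
    apply: IVT; first exact: ltW.
      exact: derivable_oo_LRcontinuous_within.
    rewrite minEle maxEle (ltW Fab).
    by move: yab; rewrite !in_itv/= => /andP[/ltW -> /ltW].
  have : `]a, b[%classic x.
    move: xab yab; rewrite -Fxy /= !in_itv/= => /andP[ax xb] /andP[h1 h2].
    rewrite !lt_neqAle ax xb !andbT; apply/andP; split; apply/eqP => e.
      by move: h1; rewrite e ltxx.
    by move: h2; rewrite e ltxx.
  rewrite D_E => -[n _ xn]; exists n => //=.
  have [un vn] := uv n.
  move: xn; rewrite /= !in_itv/= -/(u n) -/(v n) => /andP[h1 h2].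
  rewrite -Fxy; apply/andP; split.
    move: h1; rewrite le_eqVlt => /predU1P[->//|h1].
    by apply/ltW/incF => //; exact: subset_itv_oo_cc.
  move: h2; rewrite le_eqVlt => /predU1P[->//|h2].
  by apply/ltW/incF => //; exact: subset_itv_oo_cc.
rewrite D_E E_E; apply: ge0_integration_by_substitution_bigcup.
- move=> n; rewrite /u /v.
  have : (b - a) / n.+2%:R <= (b - a) / 2.
    by rewrite ler_pM2l// lef_pV2// ?posrE// ler_nat.
  by move: (_ / n.+2%:R) => e h; lra.
- by move=> n m nm; rewrite lerD2l ler_pM2l// lef_pV2 ?posrE// ler_nat.
- by move=> n m nm; rewrite lerD2l lerN2 ler_pM2l// lef_pV2 ?posrE// ler_nat.
- rewrite -D_E => x y xab yab; apply: incF; exact: subset_itv_oo_cc.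
- by rewrite -D_E; case: dF.
- by rewrite -D_E => x /cF'.
- by rewrite -D_E => x /F'0.
- by rewrite -E_E => x /cG.
- by rewrite -E_E => x /G0.
Qed.

(** The half-line counterpart, where the exhaustion also grows to the right. It moves a Gamma
    integral to []x, +oo[] in [gammaE_mul]. *)
Lemma ge0_integration_by_translation_oy G (a : R) :
  {in `]0, +oo[, continuous G} ->
  {in `]0, +oo[, forall y, 0 <= G y} ->
  (\int[mu]_(y in `]0%R, +oo[) (G y)%:E =
   \int[mu]_(x in `]a, +oo[) (G (x - a))%:E)%E.
Proof.
move=> cG G0.
have dF (x : R) : is_derive x (1 : R) (fun u : R => u - a) (1 : R).
  by apply: is_derive_eq; rewrite subr0.
have F'1 : derive1 (fun u : R => u - a) = cst 1.
  by apply/funext => x; rewrite derive1E derive_val.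
have E (c : R) : `]c, +oo[%classic = \bigcup_n `[c + n.+1%:R^-1, c + n.+1%:R]%classic.
  apply/seteqP; split => [x /=|x [n _ /=]]; last first.
    have : 0 < n.+1%:R^-1 :> R by rewrite invr_gt0.
    by rewrite !in_itv/= andbT; move: (_^-1) => e h1 /andP[h2 h3]; lra.
  rewrite in_itv/= andbT -subr_gt0 => xc.
  have [n _ hn] := near_infty_natSinv_lt (PosNum xc).
  have [m _ hm] := nbhs_infty_ger (x - c).
  exists (maxn n m) => //=; rewrite in_itv/=.
  have /= := hn (maxn n m) (leq_maxl _ _).
  have /= := hm (maxn n m) (leq_maxr _ _).
  by rewrite -natr1 => h1 h2; apply/andP; split; lra.
have Ea : `]0, +oo[%classic = \bigcup_n `[a + n.+1%:R^-1 - a, a + n.+1%:R - a]%classic.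
  rewrite E; apply: eq_bigcupr => n _.
  by rewrite !add0r ![a + _]addrC !addrK.
rewrite Ea E.
rewrite (ge0_integration_by_substitution_bigcup (F := fun u => u - a))//.
- by apply: eq_integral => x _; rewrite F'1 mulr1.
- by move=> n; rewrite lerD2l (@le_trans _ _ 1)// ?ler1n// invf_le1// ler1n.
- by move=> n m nm; rewrite lerD2l lef_pV2 ?posrE// ler_nat.
- by move=> n m nm; rewrite lerD2l ler_nat.
- by move=> x y _ _; rewrite ltrD2r.
- by move=> x _; rewrite F'1; exact: cst_continuous.
- by move=> x _; rewrite F'1.
- by rewrite -Ea => x /cG.
- by rewrite -Ea => x /G0.
Qed.

End substitution.

(** * Beta and Gamma integrals with real parameters *)

Section beta_gamma.
Context {R : realType}.
Notation mu := (@lebesgue_measure R).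
Implicit Types (p q z : R).

(** Both Euler integrals are kept in [\bar R], so that Tonelli and scaling apply before any
    convergence is known. Finiteness of [betaE] is then a by-product of [betaE_Gamma]. *)
Definition betaE p q : \bar R :=
  (\int[mu]_(s in `]0%R, 1%R[) (s `^ (p - 1) * (1 - s) `^ (q - 1))%:E)%E.

Definition gammaE z : \bar R :=
  (\int[mu]_(t in `]0%R, +oo[) (t `^ (z - 1) * expR (- t))%:E)%E.

Lemma continuous_powR z : {in `]0, +oo[, continuous (@powR R ^~ z)}.
Proof.
move=> x x0; apply/differentiable_continuous/derivable1_diffP.
exact: derivable_powR.
Qed.

Lemma powR_derive1E z x : 0 < x -> derive1 (@powR R ^~ z) x = z * x `^ (z - 1).
Proof. by move=> x0; rewrite powR_derive1// in_itv/= x0. Qed.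

(* Substitution of [y = s `^ z] in the integral of 1 over ]0, 1[. *)
Lemma integral_powR_oo01 z : 0 < z ->
  (\int[mu]_(s in `]0%R, 1%R[) (s `^ (z - 1))%:E = (z^-1)%:E)%E.
Proof.
move=> z0.
have oo1 : `](0 : R), 1[%classic `<=` `]0, +oo[%classic by exact: subset_itvl.
have F01 : (\int[mu]_(y in `](0 `^ z)%R, (1 `^ z)%R[) 1%:E = 1)%E.
  rewrite powR0 ?gt_eqF// powR1 integral_cst//= lebesgue_measure_itv/= lte_fin ltr01.
  by rewrite oppr0 adde0 mule1.
have := @ge0_integration_by_substitution_oo R (@powR R ^~ z) (cst 1) 0 1 ltr01.
rewrite F01 => E.
have {}E : (1 = \int[mu]_(x in `]0%R, 1%R[) (z * x `^ (z - 1))%:E)%E.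
  rewrite E.
  - apply: eq_integral => x; rewrite inE/= in_itv/= => /andP[x0 _].
    by rewrite mul1r powR_derive1E.
  - move=> x y; rewrite !in_itv/= => /andP[x0 _] /andP[y0 _].
    by apply: gt0_ltr_powR; rewrite ?nnegrE.
  - split.
    + by move=> x /oo1; exact: derivable_powR.
    + by rewrite powR0 ?gt_eqF//; exact: powR_cvg0.
    + apply: cvg_at_left_filter; apply: continuous_powR.
      by rewrite in_itv/= ltr01.
  - move=> x x01.
    have x0 := oo1 _ x01.
    have nE : {near x, (fun y => z * y `^ (z - 1)) =1 derive1 (@powR R ^~ z)}.
      have := near_in_itvoy x0.
      apply: filterS => y; rewrite in_itv/= andbT => y0.
      by rewrite powR_derive1E.
    apply: (cvg_trans (near_eq_cvg nE)).
    rewrite -(nbhs_singleton nE).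
    by apply: cvgM; [exact: cvg_cst|exact: continuous_powR].
  - move=> x; rewrite in_itv/= => /andP[x0 _].
    by rewrite powR_derive1E// mulr_ge0 ?powR_ge0// ltW.
  - by move=> x _; exact: cst_continuous.
  - by [].
move: E; under eq_integral do rewrite EFinM.
rewrite ge0_integralZl//=; last 3 first.
- apply/measurable_EFinP; apply: measurable_funTS; exact: measurable_powR.
- by move=> x _; rewrite lee_fin powR_ge0.
- by rewrite lee_fin ltW.
move=> /(congr1 (fun x => (z^-1)%:E * x)%E).
by rewrite mule1 muleA -EFinM mulVf ?gt_eqF// mul1e => ->.
Qed.

Lemma integral_expRN_oy (r : R) : 0 < r ->
  (\int[mu]_(t in `]0%R, +oo[) (expR (- (r * t)))%:E = (r^-1)%:E)%E.
Proof.
move=> r0.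
have cE : continuous (fun t : R => expR (- (r * t))).
  move=> x; apply: continuous_comp; last exact: continuous_expR.
  by apply: continuousN; apply: continuousM; [exact: cst_continuous|exact: cvg_id].
have dF (x : R) : is_derive x (1 : R) (fun t : R => - (r^-1 * expR (- (r * t))))
    (expR (- (r * x))).
  have h : is_derive x (1 : R) (fun t : R => - (r * t)) (- r).
    by apply: is_derive_eq; rewrite scaler1.
  have h2 := @is_derive1_comp R expR (fun t : R => - (r * t)) x _ _ (is_derive_expR _) h.
  apply: is_derive_eq.
  rewrite mulrN scalerN opprK.
  by rewrite /GRing.scale/= mulrCA mulVf ?gt_eqF// mulr1.
have cF (x : R) : {for x, continuous (fun t : R => - (r^-1 * expR (- (r * t))))}.
  by apply/differentiable_continuous/derivable1_diffP.
rewrite integral_itv_obnd_cbnd; last first.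
  apply/measurable_EFinP; apply: measurable_funTS.
  exact: continuous_measurable_fun.
rewrite (@ge0_continuous_FTC2y _ _ (fun t : R => - (r^-1 * expR (- (r * t)))) 0 0)//.
- by rewrite mulr0 oppr0 expR0 mulr1 EFinN oppeK add0e.
- exact: continuous_subspaceT.
- rewrite -oppr0; apply: cvgN; rewrite -(mulr0 r^-1); apply: cvgM; first exact: cvg_cst.
  apply: (@cvg_comp _ _ _ (fun t => r * t) (fun t => expR (- t)) _ +oo%R); last exact: cvgr_expR.
  exact: gt0_cvgMry.
- by apply: cvg_at_right_filter; exact: cF.
- by move=> x _; rewrite derive1E derive_val.
Qed.

(** This is [ln y < y] at [y = x / s]. The free scale [s] makes the slope as small as desired, which
    bounds a power by a slow exponential in [gammaE_lty]. *)
Lemma ln_le_affine (s x : R) : 0 < s -> 0 < x -> ln x <= x / s + ln s.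
Proof.
move=> s0 x0.
have := ln_sublinear (divr_gt0 x0 s0).
rewrite lnM ?posrE ?invr_gt0// lnV ?posrE//; lra.
Qed.

Lemma measurable_fun_powRl d (T : measurableType d) (D : set T) (f : T -> R) z :
  measurable_fun D f -> measurable_fun D (fun x => f x `^ z).
Proof.
by move=> mf; apply: (@measurableT_comp _ _ _ _ _ _ (@powR R ^~ z)).
Qed.

Lemma measurable_gamma_kernel z (D : set R) : measurable D ->
  measurable_fun D (fun t : R => t `^ (z - 1) * expR (- t)).
Proof.
move=> mD; apply: measurable_funTS; apply: measurable_funM.
  exact: measurable_powR.
by apply: measurableT_comp; [exact: measurable_expR|exact: oppr_measurable].
Qed.

Lemma gammaE_lty z : 0 < z -> (gammaE z < +oo)%E.
Proof.
move=> z0.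
have U : `]0%R, +oo[%classic = `]0%R, 1%R[ `|` `[1%R, +oo[ :> set R.
  by rewrite -(@itv_bndbnd_setU _ _ (BRight (0:R)) (BLeft 1) +oo%O)// bnd_simp.
have k0 t : (0 <= (t `^ (z - 1) * expR (- t))%:E)%E.
  by rewrite lee_fin mulr_ge0 ?powR_ge0 ?expR_ge0.
rewrite /gammaE U ge0_integral_setU//=; last 2 first.
- by apply/measurable_EFinP; apply: measurable_gamma_kernel; exact: measurableU.
- apply/disj_setPS => t [] /=; rewrite !in_itv/= andbT => /andP[_ t1].
  by rewrite leNgt t1.
apply: lte_add_pinfty.
  apply: (@le_lt_trans _ _ (\int[mu]_(t in `]0%R, 1%R[) (t `^ (z - 1))%:E)%E).
    apply: ge0_le_integral => //=.
    - by apply/measurable_EFinP; exact: measurable_gamma_kernel.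
    - by apply/measurable_EFinP; apply: measurable_funTS; exact: measurable_powR.
    - move=> t; rewrite in_itv/= => /andP[t0 _].
      by rewrite lee_fin ler_piMr ?powR_ge0// -expR0 ler_expR oppr_le0 ltW.
  by rewrite integral_powR_oo01// ltry.
(* On [[1, +oo[] the logarithm is nonnegative, so [z - 1] may be raised to a positive [M]. Then
   [ln_le_affine] at scale [2 * M] gives [M * ln t <= t / 2 + M * ln (2 * M)]: half of the
   exponential decay survives, and [C] is what remains. *)
pose M := Num.max 1 (z - 1).
have M0 : 0 < M by rewrite lt_max ltr01.
pose C := expR (M * ln (2 * M)).
apply: (@le_lt_trans _ _
   (\int[mu]_(t in `]0%R, +oo[) (C%:E * (expR (- (2^-1 * t)))%:E))%E).
  apply: (@le_trans _ _
   (\int[mu]_(t in `[1%R, +oo[) (C%:E * (expR (- (2^-1 * t)))%:E))%E).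
    apply: ge0_le_integral => //=.
    - by apply/measurable_EFinP; exact: measurable_gamma_kernel.
    - apply/measurable_EFinP; apply: measurable_funTS.
      apply: measurable_funM => //; apply: measurableT_comp => //.
      apply: measurableT_comp => //; exact: measurable_funM.
    - move=> t; rewrite in_itv/= andbT => t1.
      have t0 : 0 < t by apply: lt_le_trans t1.
      rewrite -EFinM lee_fin /powR gt_eqF// /C -!expRD ler_expR.
      have h1 : (z - 1) * ln t <= M * ln t.
        by rewrite ler_wpM2r ?ln_ge0// le_max lexx orbT.
      have h2 : M * ln t <= M * (t / (2 * M) + ln (2 * M)).
        by rewrite ler_wpM2l ?(ltW M0)// ln_le_affine// mulr_gt0.
      have h3 : M * (t / (2 * M)) = 2^-1 * t by field; rewrite gt_eqF.
      rewrite mulrDr h3 in h2; lra.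
  apply: ge0_subset_integral => //=.
  - apply/measurable_EFinP; apply: measurable_funTS.
    apply: measurable_funM => //; apply: measurableT_comp => //.
    apply: measurableT_comp => //; exact: measurable_funM.
  - by move=> t _; rewrite -EFinM lee_fin mulr_ge0 ?expR_ge0.
  - by apply: subset_itvr; rewrite bnd_simp.
rewrite ge0_integralZl//=; last 2 first.
- apply/measurable_EFinP; apply: measurable_funTS.
  by apply: measurableT_comp => //; apply: measurableT_comp => //; exact: measurable_funM.
- by rewrite lee_fin expR_ge0.
by rewrite integral_expRN_oy// -EFinM ltry.
Qed.

(** On []0, 1[] the exponential is at least [expR (-1)], which leaves the explicit lower bound
    [expR (-1) / z]. *)
Lemma gammaE_gt0 z : 0 < z -> (0 < gammaE z)%E.
Proof.
move=> z0.
apply: (@lt_le_trans _ _ (\int[mu]_(t in `]0%R, 1%R[) ((expR (-1))%:E * (t `^ (z - 1))%:E))%E).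
  rewrite ge0_integralZl//=; last 2 first.
  - by apply/measurable_EFinP; apply: measurable_funTS; exact: measurable_powR.
  - by move=> t _; rewrite lee_fin powR_ge0.
  by rewrite integral_powR_oo01// -EFinM lte_fin mulr_gt0 ?expR_gt0 ?invr_gt0.
apply: (@le_trans _ _ (\int[mu]_(t in `]0%R, 1%R[) (t `^ (z - 1) * expR (- t))%:E)%E).
  apply: ge0_le_integral => //=.
  - by move=> t _; rewrite -EFinM lee_fin mulr_ge0 ?expR_ge0 ?powR_ge0.
  - apply/measurable_EFinP; apply: measurable_funTS.
    by apply: measurable_funM => //; exact: measurable_powR.
  - by apply/measurable_EFinP; exact: measurable_gamma_kernel.
  - move=> t; rewrite in_itv/= => /andP[t0 t1].
    by rewrite -EFinM lee_fin mulrC ler_wpM2l ?powR_ge0// ler_expR lerN2 ltW.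
apply: ge0_subset_integral => //=.
- by apply/measurable_EFinP; exact: measurable_gamma_kernel.
- by move=> t _; rewrite lee_fin mulr_ge0 ?expR_ge0 ?powR_ge0.
- by apply: subset_itvl; rewrite bnd_simp.
Qed.

(** A real-valued integral defaults to 0 when the extended one is infinite; finiteness rules this
    out. *)
Lemma gammaEE z : 0 < z -> gammaE z = (Gamma z)%:E.
Proof.
move=> z0; rewrite /Gamma /Rintegral fineK//.
by rewrite ge0_fin_numE ?gammaE_lty// ltW// gammaE_gt0.
Qed.

Lemma Gamma_gt0 z : 0 < z -> 0 < Gamma z.
Proof. by move=> z0; rewrite -lte_fin -gammaEE// gammaE_gt0. Qed.

Lemma integral_beta_itv p q (c d : R) : c < d ->
  (\int[mu]_(u in `]c, d[) ((u - c) `^ (p - 1) * (d - u) `^ (q - 1))%:E =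
   ((d - c) `^ (p + q - 1))%:E * betaE p q)%E.
Proof.
move=> cd; have L0 : 0 < d - c by rewrite subr_gt0.
have dF (x : R) : is_derive x (1 : R) (fun u : R => (d - c)^-1 * (u - c)) (d - c)^-1.
  by apply: is_derive_eq; rewrite subr0 scaler1.
have F'E : derive1 (fun u : R => (d - c)^-1 * (u - c)) = cst (d - c)^-1.
  by apply/funext => x; rewrite derive1E derive_val.
have dFc (x : R) : {for x, continuous (fun u : R => (d - c)^-1 * (u - c))}.
  by apply/differentiable_continuous/derivable1_diffP.
have := @ge0_integration_by_substitution_oo R (fun u : R => (d - c)^-1 * (u - c))
  (fun s => s `^ (p - 1) * (1 - s) `^ (q - 1)) c d cd.
rewrite /= subrr mulr0 mulVf ?gt_eqF// -/(betaE p q) => ->.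
- rewrite -ge0_integralZl//=; last 3 first.
  + apply/measurable_EFinP; rewrite F'E; apply: measurable_funTS.
    apply: measurable_funM => //; apply: measurable_funM.
      apply: measurable_fun_powRl.
      by apply: measurable_funM => //; exact: measurable_funB.
    apply: measurable_fun_powRl.
    apply: measurable_funB => //.
    by apply: measurable_funM => //; exact: measurable_funB.
  + by move=> x _; rewrite F'E lee_fin !mulr_ge0 ?powR_ge0 ?invr_ge0 ?ltW.
  + by rewrite lee_fin powR_ge0.
  apply: eq_integral => u; rewrite inE/= in_itv/= => /andP[cu ud].
  rewrite F'E -EFinM; congr EFin => /=.
  have -> : 1 - (d - c)^-1 * (u - c) = (d - c)^-1 * (d - u).
    by field; rewrite gt_eqF.
  have uc0 : 0 <= u - c by rewrite subr_ge0 ltW.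
  have du0 : 0 <= d - u by rewrite subr_ge0 ltW.
  have iL : 0 <= (d - c)^-1 by rewrite invr_ge0 ltW.
  (* The three summands match the powers of [d - c] coming from the two factors and from the
     derivative of the substitution. *)
  have -> : p + q - 1 = (p - 1) + (q - 1) + 1 by ring.
  rewrite !powRM//; move: (p - 1) (q - 1) => P Q.
  have LN0 : d - c != 0 by rewrite gt_eqF.
  rewrite !powRD ?LN0 ?implybT// powRr1 ?(ltW L0)//.
  rewrite -(powR_inv1 (ltW L0)) -!powRrM !mulN1r !powRN !powRr1 ?(ltW L0)//.
  have := powR_gt0 P L0; have := powR_gt0 Q L0.
  move: ((d - c) `^ Q) => B B0; move: ((d - c) `^ P) => A A0.
  field.
  by rewrite LN0 !gt_eqF.
- move=> x y _ _ xy; rewrite ltr_pM2l ?invr_gt0//; lra.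
- split => //; first by apply: cvg_at_right_filter; exact: dFc.
  by apply: cvg_at_left_filter; exact: dFc.
- by move=> x _; rewrite F'E; exact: cst_continuous.
- by move=> x _; rewrite F'E invr_ge0 ltW.
- move=> x; rewrite in_itv/= => /andP[x0 x1].
  have h1 : x \in `]0, +oo[ by rewrite in_itv/= x0.
  have h2 : 1 - x \in `]0, +oo[ by rewrite in_itv/= subr_gt0 x1.
  apply: cvgM; first exact: continuous_powR.
  apply: (@cvg_comp _ _ _ (fun s => 1 - s) (@powR R ^~ (q - 1)) _ (nbhs (1 - x))).
    by apply: cvgB; [exact: cvg_cst|exact: cvg_id].
  exact: continuous_powR.
- by move=> x _; rewrite mulr_ge0 ?powR_ge0.
Qed.

(** [powR] does not vanish at negative bases. The cut-off writes the triangle [0 < x < u] into the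
    integrand, so that Tonelli applies on the whole plane. *)
Let pospow p (x : R) : R := if 0 < x then x `^ (p - 1) else 0.

Let measurable_pospow p : measurable_fun [set: R] (pospow p).
Proof.
by apply: measurable_fun_ifT => //; exact: measurable_fun_ltr.
Qed.

Let pospow_ge0 p x : 0 <= pospow p x.
Proof. by rewrite /pospow; case: ifP => // _; exact: powR_ge0. Qed.

(* Tonelli for [x^(p-1) (u-x)^(q-1) e^(-u)] on [0 < x < u]: the integral in [u]
   first is a translated Gamma integral, in [x] first a rescaled Beta integral. *)
Lemma gammaE_mul p q : 0 < p -> 0 < q ->
  (gammaE p * gammaE q = betaE p q * gammaE (p + q))%E.
Proof.
move=> p0 q0.
pose f (xu : R * R) : \bar R :=
  (pospow p xu.1 * pospow q (xu.2 - xu.1) * expR (- xu.2))%:E.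
have f0 xu : (0 <= f xu)%E.
  by rewrite lee_fin !mulr_ge0 ?pospow_ge0 ?expR_ge0.
have mf : measurable_fun [set: R * R] f.
  apply/measurable_EFinP; apply: measurable_funM; first apply: measurable_funM.
  - exact: (measurableT_comp (measurable_pospow p) measurable_fst).
  - apply: (measurableT_comp (measurable_pospow q)).
    exact: measurable_funB.
  - by apply: measurableT_comp => //; exact: measurableT_comp.
have := @fubini_tonelli _ _ _ _ R mu mu f mf f0.
have -> : (\int[mu]_x \int[mu]_u f (x, u) = gammaE p * gammaE q)%E.
  transitivity (\int[mu]_(x in `]0%R, +oo[)
      ((x `^ (p - 1) * expR (- x))%:E * gammaE q))%E.
    rewrite [RHS]integral_mkcond; apply: eq_integral => x _.
    rewrite patchE; case: ifPn; rewrite mem_setE in_itv/= andbT => x0; last first.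
      rewrite (eq_integral (cst 0%E)) ?integral0// => u _.
      by rewrite /f/= /pospow (negbTE x0) !mul0r.
    rewrite /gammaE (ge0_integration_by_translation_oy x); last 2 first.
    - move=> y y0; apply: cvgM; first exact: continuous_powR.
      apply: (@cvg_comp _ _ _ (fun s => - s) expR _ (nbhs (- y))).
        by apply: cvgN; exact: cvg_id.
      exact: continuous_expR.
    - by move=> y _; rewrite mulr_ge0 ?powR_ge0 ?expR_ge0.
    rewrite -ge0_integralZl//=; last 3 first.
    - apply/measurable_EFinP; apply: measurable_funTS.
      apply: measurable_funM; last first.
        by do 2 (apply: measurableT_comp => //); exact: measurable_funB.
      by apply: measurable_fun_powRl; exact: measurable_funB.
    - by move=> u _; rewrite lee_fin mulr_ge0 ?powR_ge0 ?expR_ge0.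
    - by rewrite lee_fin mulr_ge0 ?powR_ge0 ?expR_ge0.
    rewrite [RHS]integral_mkcond; apply: eq_integral => u _.
    rewrite patchE /f/= /pospow x0 subr_gt0; case: ifPn.
      rewrite mem_setE in_itv/= andbT => xu; rewrite xu -EFinM; congr EFin.
      rewrite opprB expRD !expRN; field.
      by rewrite !gt_eqF ?expR_gt0.
    rewrite mem_setE in_itv/= andbT => /negbTE ->.
    by rewrite mulr0 mul0r.
  rewrite ge0_integralZr//=.
  - by apply/measurable_EFinP; exact: measurable_gamma_kernel.
  - by move=> u _; rewrite lee_fin mulr_ge0 ?powR_ge0 ?expR_ge0.
  - by rewrite ltW// gammaE_gt0.
have -> // : (\int[mu]_u \int[mu]_x f (x, u) = betaE p q * gammaE (p + q))%E.
have b0 : (0 <= betaE p q)%E.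
  by apply: integral_ge0 => s _; rewrite lee_fin mulr_ge0 ?powR_ge0.
rewrite -ge0_integralZl//=; last 2 first.
- by apply/measurable_EFinP; exact: measurable_gamma_kernel.
- by move=> u _; rewrite lee_fin mulr_ge0 ?powR_ge0 ?expR_ge0.
rewrite [RHS]integral_mkcond; apply: eq_integral => u _.
rewrite patchE; case: ifPn; rewrite mem_setE in_itv/= andbT => u0; last first.
  rewrite (eq_integral (cst 0%E)) ?integral0// => x _.
  rewrite /f/= /pospow; case: ifPn => [x0|_]; last by rewrite !mul0r.
  rewrite subr_gt0; case: ifPn => [xu|_]; last by rewrite mulr0 mul0r.
  by rewrite (lt_trans x0 xu) in u0.
rewrite EFinM [RHS]muleA [X in (X * _)%E]muleC.
have := integral_beta_itv p q u0; rewrite subr0 => <-.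
rewrite -ge0_integralZr//=; last 2 first.
- apply/measurable_EFinP; apply: measurable_funTS; apply: measurable_funM.
    by apply: measurable_fun_powRl; exact: measurable_funB.
  by apply: measurable_fun_powRl; exact: measurable_funB.
- by move=> x _; rewrite lee_fin mulr_ge0 ?powR_ge0 ?expR_ge0.
rewrite [RHS]integral_mkcond; apply: eq_integral => x _.
rewrite patchE subr0; case: ifPn; rewrite mem_setE in_itv/=.
  by move=> /andP[x0 xu]; rewrite /f/= /pospow subr_gt0 x0 xu.
rewrite /f/= /pospow subr_gt0 negb_and => /orP[/negbTE ->|/negbTE ->].
  by rewrite !mul0r.
by rewrite mulr0 mul0r.
Qed.

Lemma betaE_Gamma p q : 0 < p -> 0 < q ->
  betaE p q = (Gamma p * Gamma q / Gamma (p + q))%:E.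
Proof.
move=> p0 q0; have pq0 : 0 < p + q by rewrite addr_gt0.
have := gammaE_mul p0 q0; rewrite !gammaEE// => E.
rewrite EFinM EFinM E -muleA -EFinM divff ?mule1//.
by rewrite gt_eqF// Gamma_gt0.
Qed.

Lemma Gamma1 : Gamma (1 : R) = 1.
Proof.
apply: EFin_inj; rewrite -gammaEE//.
have := @integral_expRN_oy 1 ltr01; rewrite invr1 => <-.
apply: eq_integral => t _.
by rewrite subrr powRr0 !mul1r.
Qed.

(** Instead of integrating by parts, the Beta integral with second parameter 1 is evaluated directly
    as [p^-1] and compared with its Gamma quotient. *)
Lemma GammaD1 p : 0 < p -> Gamma (p + 1) = p * Gamma p.
Proof.
move=> p0; have p10 : 0 < p + 1 by rewrite addr_gt0.
have := betaE_Gamma p0 ltr01; rewrite Gamma1 mulr1.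
have -> : betaE p 1 = (p^-1)%:E.
  rewrite -integral_powR_oo01//; apply: eq_integral => s _.
  by rewrite subrr powRr0 mulr1.
move=> [E]; have g0 : Gamma (p + 1) != 0 by rewrite gt_eqF// Gamma_gt0.
have pn0 : p != 0 by rewrite gt_eqF.
by apply: (mulfI (invr_neq0 pn0)); rewrite mulKf// E divfK.
Qed.

End beta_gamma.

(** * Derivatives relative to a set *)

Section derive_within.
Context {R : realType}.
Implicit Types (A J : set R) (h f g : R -> R) (x l : R).

(** The derivative behind [is_derive] is a limit in the increment at 0; translation by [x] carries
    punctured balls to punctured balls. *)
Lemma cvg_diff_quotient_is_derive h x l :
  diff_quotient h x y @[y --> x^'] --> l <-> is_derive x (1 : R) h l.
Proof.
have E : diff_quotient h x y @[y --> x^'] --> l <->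
    u^-1 *: ((h \o shift x) (u *: (1 : R)) - h x) @[u --> 0^'] --> l.
  split => /cvgrPdist_lt H; apply/cvgrPdist_lt => e e0.
    have [d /= d0 Hd] := (nbhs_ballP _ _).1 (H e e0).
    apply/nbhs_ballP; exists d => //= u; rewrite /ball/= sub0r normrN => ud u0.
    have := Hd (u + x); rewrite /ball/= opprD addrCA subrr addr0 normrN.
    rewrite /diff_quotient /= addrK /GRing.scale/= mulr1 [u^-1 * _]mulrC.
    by apply=> //; rewrite -subr_eq0 addrK.
  have [d /= d0 Hd] := (nbhs_ballP _ _).1 (H e e0).
  apply/nbhs_ballP; exists d => //= u; rewrite /ball/= => ud ux.
  have := Hd (u - x); rewrite /ball/= sub0r opprB.
  rewrite /diff_quotient /GRing.scale/= mulr1 subrK [(u - x)^-1 * _]mulrC.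
  by apply=> //; rewrite subr_eq0.
rewrite E; split.
  move=> H; apply: DeriveDef; first by apply/cvg_ex; exists l.
  exact: cvg_lim.
by case=> /cvg_ex [l' H] <-; rewrite /derive; rewrite (cvg_lim _ H).
Qed.

Lemma cvg_diff_quotient_continuous A f x l :
  diff_quotient f x y @[y --> within A x^'] --> l ->
  f y @[y --> within A x^'] --> f x.
Proof.
move=> H.
have hx : (y - x) @[y --> within A x^'] --> 0.
  rewrite -(subrr x); apply: cvgB; last exact: cvg_cst.
  by apply: cvg_within_filter; apply: cvg_within_filter; exact: cvg_id.
have : f x + diff_quotient f x y * (y - x) @[y --> within A x^'] --> f x + l * 0.
  by apply: cvgD; [exact: cvg_cst|exact: cvgM].
rewrite mulr0 addr0.
apply: cvg_trans; apply: near_eq_cvg.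
rewrite /dnbhs !near_withinE; apply: filterE => y /= yx _.
by rewrite /diff_quotient divfK ?subr_eq0// addrC subrK.
Qed.

(* Caratheodory: the difference quotient of [g] at [f x], completed by its limit
   at [f x], is continuous and handles the [y] with [f y = f x]. *)
Lemma cvg_diff_quotient_comp A f g x l m :
  diff_quotient f x y @[y --> within A x^'] --> l ->
  is_derive (f x) (1 : R) g m ->
  diff_quotient (g \o f) x y @[y --> within A x^'] --> m * l.
Proof.
move=> fl /cvg_diff_quotient_is_derive gm.
pose q u := if u == f x then m else diff_quotient g (f x) u.
have cq : q u @[u --> f x] --> m.
  have qfx : q (f x) = m by rewrite /q eqxx.
  rewrite -qfx; apply/continuous_withinNx; rewrite qfx.
  apply: cvg_trans gm; apply: near_eq_cvg; rewrite /dnbhs near_withinE.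
  by apply: filterE => u /negbTE ufx; rewrite /q ufx.
have fx := cvg_diff_quotient_continuous fl.
have : q (f y) * diff_quotient f x y @[y --> within A x^'] --> m * l.
  by apply: cvgM => //; exact: cvg_comp fx cq.
apply: cvg_trans; apply: near_eq_cvg.
apply: filterE => y /=; rewrite /q; case: eqP => [fyx|/eqP fyx].
  by rewrite /diff_quotient /= fyx !subrr !mul0r mulr0.
by rewrite /diff_quotient /= mulrA divfK// subr_eq0.
Qed.

Lemma near_eq_cvg_diff_quotient A f g x l :
  f x = g x -> (\forall y \near within A x^', f y = g y) ->
  diff_quotient f x y @[y --> within A x^'] --> l ->
  diff_quotient g x y @[y --> within A x^'] --> l.
Proof.
move=> fgx fg; apply: cvg_trans; apply: near_eq_cvg.
by apply: filterS fg => y fgy; rewrite /diff_quotient fgx fgy.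
Qed.

(** Every point of a nondegenerate interval is an accumulation point of it, approached from the
    right unless it is [b]. Limits along this filter are therefore unique, so that [derive_within]
    has the value that a convergence proof exhibits. *)
Lemma itvcc_dnbhs_proper (a b x : R) : a < b -> x \in `[a, b] ->
  ProperFilter (within `[a, b]%classic x^').
Proof.
move=> ab; rewrite in_itv/= => /andP[ax xb].
apply: Build_ProperFilter_ex => P HP0.
have [e /= e0 HP] := (nbhs_ballP _ _).1 (HP0 : nbhs x _).
have [xltb|] := ltP x b.
  pose y := Num.min b (x + e / 2).
  have xy : x < y by rewrite lt_min xltb ltrDl divr_gt0.
  exists y; apply: HP.
  - have : y <= x + e / 2 by rewrite ge_min lexx orbT.
    rewrite /ball/= ltr0_norm; lra.
  - by rewrite /= gt_eqF.
  - rewrite /= in_itv/= (ltW (le_lt_trans ax xy))/=.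
    by rewrite ge_min lexx.
move=> bx; have {xb}bx : x = b by apply/eqP; rewrite eq_le xb bx.
pose y := Num.max a (x - e / 2).
have xy : y < x by rewrite gt_max bx ab/= ltrBlDr ltrDl divr_gt0.
exists y; apply: HP.
- have : x - e / 2 <= y by rewrite le_max lexx orbT.
  rewrite /ball/= gtr0_norm; lra.
- by rewrite /= lt_eqF.
- rewrite /= in_itv/= -bx (ltW xy) andbT.
  by rewrite le_max lexx.
Qed.

Lemma cvg_derive_within (a b : R) f x l : a < b -> x \in `[a, b] ->
  diff_quotient f x y @[y --> within `[a, b]%classic x^'] --> l ->
  derive_within `[a, b]%classic f x = l.
Proof.
move=> ab xab fl; have := itvcc_dnbhs_proper ab xab => PF.
exact: cvg_lim.
Qed.

Lemma derivable_withinP (a b : R) f x : a < b -> x \in `[a, b] ->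
  derivable_within `[a, b]%classic f x ->
  diff_quotient f x y @[y --> within `[a, b]%classic x^'] -->
    derive_within `[a, b]%classic f x.
Proof.
move=> ab xab /cvg_ex[l fl].
by rewrite (cvg_derive_within ab xab fl).
Qed.

(** A small ball around an interior point lies in [[a, b]], so the relative filter is the full
    punctured one. *)
Lemma derive_within_oo (a b : R) f x : a < b -> x \in `]a, b[ ->
  derivable_within `[a, b]%classic f x ->
  is_derive x (1 : R) f (derive_within `[a, b]%classic f x).
Proof.
move=> ab xab df; apply/cvg_diff_quotient_is_derive.
have := derivable_withinP ab (subset_itv_oo_cc xab) df.
apply: cvg_trans; apply: cvg_app => P HP.
have [e /= e0 {}HP] := (nbhs_ballP _ _).1 (HP : nbhs x _).
have [d /= d0 Hd] := (nbhs_ballP _ _).1 (near_in_itvoo xab).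
apply/(nbhs_ballP x); exists (Num.min d e); first by rewrite /= lt_min d0.
move=> y /= xy yx; apply: HP => //.
  by apply: le_ball xy; rewrite ge_min lexx orbT.
apply: subset_itv_oo_cc; apply: Hd.
by apply: le_ball xy; rewrite ge_min lexx.
Qed.

(** The pair [phi], [w] covers both sides: [psi - psi a] with [1 / psi'], and [psi b - psi] with
    [- 1 / psi']. As [w * dphi = 1], each step returns a pure power of [phi] and the induction
    closes. [J] is relatively open, so values on [J] alone fix the derivatives there. *)
Lemma iter_weighted_derive_within_powR (a b : R) J (phi dphi w h : R -> R) (C c : R) :
  a < b -> J `<=` `[a, b]%classic ->
  (forall x, J x -> \forall y \near within `[a, b]%classic x^', J y) ->
  (forall x, J x ->
    diff_quotient phi x y @[y --> within `[a, b]%classic x^'] --> dphi x) ->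
  (forall x, J x -> 0 < phi x) ->
  (forall x, J x -> w x * dphi x = 1) ->
  (forall x, J x -> h x = C * phi x `^ (c - 1)) ->
  let D f x := w x * derive_within `[a, b]%classic f x in
  forall k, k%:R < c ->
  (forall x, J x ->
     iter k D h x = C * (Gamma c / Gamma (c - k%:R)) * phi x `^ (c - k%:R - 1)) /\
  (forall x, J x -> derivable_within `[a, b]%classic (iter k D h) x).
Proof.
move=> ab JA Jnear dphiE phi0 w1 hE D.
have step f C' c' : (forall x, J x -> f x = C' * phi x `^ (c' - 1)) ->
    forall x, J x -> diff_quotient f x y @[y --> within `[a, b]%classic x^'] -->
      C' * (c' - 1) * phi x `^ (c' - 1 - 1) * dphi x.
  move=> fE x Jx.
  pose g u : R := C' * u `^ (c' - 1).
  have dg : is_derive (phi x) (1 : R) g (C' * (c' - 1) * phi x `^ (c' - 1 - 1)).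
    have px : phi x \in `]0, +oo[ by rewrite in_itv/= phi0.
    have h1 : is_derive (phi x) (1 : R) (@powR R ^~ (c' - 1))
        ((c' - 1) * phi x `^ (c' - 1 - 1)).
      apply: DeriveDef; first exact: derivable_powR.
      by rewrite -derive1E powR_derive1E ?phi0.
    have := @is_deriveZ _ _ _ (@powR R ^~ (c' - 1)) C' _ _ _ h1.
    by rewrite /GRing.scale/= mulrA.
  have := cvg_diff_quotient_comp (dphiE x Jx) dg.
  apply: near_eq_cvg_diff_quotient; first by rewrite /= fE.
  by apply: filterS (Jnear x Jx) => y Jy; rewrite /= fE.
have ex f C' c' : (forall x, J x -> f x = C' * phi x `^ (c' - 1)) ->
    forall x, J x -> derivable_within `[a, b]%classic f x.
  by move=> fE x Jx; apply/cvg_ex; eexists; exact: step fE x Jx.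
have val k : k%:R < c -> forall x, J x ->
    iter k D h x = C * (Gamma c / Gamma (c - k%:R)) * phi x `^ (c - k%:R - 1).
  elim: k => [|k IH] kc x Jx.
    have c0 : 0 < c by [].
    by rewrite /= subr0 divff ?mulr1 ?hE// gt_eqF// Gamma_gt0.
  have kc' : k%:R < c by apply: lt_trans kc; rewrite ltr_nat.
  have e := step _ _ _ (IH kc') x Jx.
  rewrite iterS {1}/D (cvg_derive_within ab (JA _ Jx) e).
  rewrite mulrCA w1// mulr1.
  have -> : c - k.+1%:R - 1 = c - k%:R - 1 - 1 by rewrite -natr1; ring.
  congr (_ * _); rewrite -!mulrA; congr (C * (Gamma c * _)).
  (* Positivity comes from [k + 1 < c]. The factor in the recurrence for [Gamma] at this argument is
     the exponent brought down by the derivative. *)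
  have p0 : 0 < c - k%:R - 1 by rewrite -natr1 in kc; lra.
  have -> : c - k.+1%:R = c - k%:R - 1 by rewrite -natr1; ring.
  have := GammaD1 p0; rewrite subrK => ->.
  have := Gamma_gt0 p0; move: (Gamma _) => G G0.
  by field; rewrite !gt_eqF.
move=> k kc; split; first exact: val.
exact: ex (val k kc).
Qed.

End derive_within.

(** * Fractional integrals and derivatives of powers *)

Section fractional_integral.
Context {R : realType}.
Notation mu := (@lebesgue_measure R).
Context (a b : R) (psi : R -> R) (ab : a < b)
  (psi_incr : {in `[a, b] &, {homo psi : x y / x < y}})
  (psi_derivable : forall x, x \in `[a, b] ->
     derivable_within `[a, b]%classic psi x)
  (psi_continuous : {within `[a, b]%classic, continuous psi})
  (dpsi_continuous :
     {within `[a, b]%classic, continuous (derive_within `[a, b]%classic psi)}).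

Let dpsi := derive_within `[a, b]%classic psi.

Lemma derive_within_incr_ge0 x : x \in `[a, b] -> 0 <= dpsi x.
Proof.
move=> xab; have PF := itvcc_dnbhs_proper ab xab.
apply: limr_ge; first exact: psi_derivable.
apply/nbhs_ballP; exists 1 => //= y _ yx yab.
rewrite /diff_quotient; have [xy|xy|e] := ltgtP x y.
- by rewrite divr_ge0// subr_ge0 ltW//; exact: psi_incr.
- rewrite -(opprB (psi x)) -(opprB x) invrN mulrNN.
  by rewrite divr_ge0// subr_ge0 ltW//; exact: psi_incr.
- by rewrite e eqxx in yx.
Qed.

(** The left-sided integral takes [c = a], [d = x] with [q] the order; the right-sided one takes
    [c = x], [d = b] with [p] the order. [k] is prescribed only inside, because at the end points
    the powers take default values. The sign of [C] makes the integrand nonnegative. *)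
Lemma integral_fracint_kernel (c d p q C : R) (k : R -> R) :
  a <= c -> c < d -> d <= b -> 0 < p -> 0 < q -> 0 <= C ->
  (forall t, t \in `]c, d[ -> k t =
     dpsi t * (C * ((psi t - psi c) `^ (p - 1) * (psi d - psi t) `^ (q - 1)))) ->
  mu.-integrable `[c, d]%classic (EFin \o k) /\
  \int[mu]_(t in `[c, d]%classic) k t =
    C * (Gamma p * Gamma q / Gamma (p + q)) * (psi d - psi c) `^ (p + q - 1).
Proof.
move=> ac cd db p0 q0 C0 kE.
have sub : `[c, d] `<=` `[a, b].
  by apply: subset_itv; rewrite bnd_simp.
have suboo : `]c, d[ `<=` `]a, b[.
  by apply: subset_itv; rewrite bnd_simp.
have psicd : psi c < psi d.
  by apply: psi_incr => //; apply: sub; rewrite /= bound_itvE ltW.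
have dpsiE t : t \in `]c, d[ -> is_derive t (1 : R) psi (dpsi t).
  move=> tcd; apply: derive_within_oo => //; first exact: suboo.
  by apply/psi_derivable/sub; exact: subset_itv_oo_cc.
have d1E t : t \in `]c, d[ -> derive1 psi t = dpsi t.
  by move=> /dpsiE ?; rewrite derive1E derive_val.
have cpsi := continuous_subspaceW sub psi_continuous.
have cdpsi := continuous_subspaceW sub dpsi_continuous.
pose G u := C * ((u - psi c) `^ (p - 1) * (psi d - u) `^ (q - 1)).
have G0 u : 0 <= G u by rewrite !mulr_ge0 ?powR_ge0.
have intG : (\int[mu]_(y in `](psi c), (psi d)[) (G y)%:E =
    (C * (Gamma p * Gamma q / Gamma (p + q)) * (psi d - psi c) `^ (p + q - 1))%:E)%E.
  rewrite /G; under eq_integral do rewrite EFinM.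
  rewrite ge0_integralZl//=.
  - rewrite integral_beta_itv// betaE_Gamma// -!EFinM; congr EFin; ring.
  - apply/measurable_EFinP; apply: measurable_funTS; apply: measurable_funM.
      by apply: measurable_fun_powRl; exact: measurable_funB.
    by apply: measurable_fun_powRl; exact: measurable_funB.
  - by move=> x _; rewrite lee_fin mulr_ge0 ?powR_ge0.
have := @ge0_integration_by_substitution_oo R psi G c d cd.
rewrite intG => S.
have {}S : ((C * (Gamma p * Gamma q / Gamma (p + q)) * (psi d - psi c) `^ (p + q - 1))%:E
    = \int[mu]_(t in `]c, d[) (k t)%:E)%E.
  rewrite S.
  - apply: eq_integral => t; rewrite inE/= => tcd.
    by rewrite kE// d1E// mulrC.
  - by move=> x y xcd ycd; apply: psi_incr; exact: sub.
  - have [_ cr cl] := (continuous_within_itvP _ cd).1 cpsi.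
    by split => // t /dpsiE.
  - have [cdp _ _] := (continuous_within_itvP _ cd).1 cdpsi.
    move=> t tcd; rewrite /continuous_at d1E//.
    apply: cvg_trans (cdp t tcd); apply: near_eq_cvg.
    by apply: filterS (near_in_itvoo tcd) => s scd; rewrite d1E.
  - move=> t tcd; rewrite d1E//; apply/derive_within_incr_ge0/sub.
    exact: subset_itv_oo_cc.
  - move=> u; rewrite in_itv/= => /andP[cu ud].
    apply: cvgM; first exact: cvg_cst.
    apply: cvgM.
      apply: (@cvg_comp _ _ _ (fun s => s - psi c) (@powR R ^~ (p - 1)) _ (nbhs (u - psi c))).
        by apply: cvgB; [exact: cvg_id|exact: cvg_cst].
      by apply: continuous_powR; rewrite in_itv/= subr_gt0 cu.
    apply: (@cvg_comp _ _ _ (fun s => psi d - s) (@powR R ^~ (q - 1)) _ (nbhs (psi d - u))).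
      by apply: cvgB; [exact: cvg_cst|exact: cvg_id].
    by apply: continuous_powR; rewrite in_itv/= subr_gt0 ud.
  - by move=> u _; exact: G0.
have mko : measurable_fun `]c, d[%classic k.
  apply: (@eq_measurable_fun _ _ _ _ _ (fun t => dpsi t * G (psi t))).
    by move=> t; rewrite inE/= => tcd; rewrite kE.
  apply: (@measurable_funS _ _ _ _ `[c, d]%classic) => //.
    exact: subset_itv_oo_cc.
  have mpsi := subspace_continuous_measurable_fun (measurable_itv `[c, d]) cpsi.
  apply: measurable_funM; first exact: subspace_continuous_measurable_fun.
  apply: measurable_funM => //; apply: measurable_funM.
    by apply: measurable_fun_powRl; exact: measurable_funB.
  by apply: measurable_fun_powRl; exact: measurable_funB.
(* The unspecified end values are adjoined one point at a time. *)
have mkoc : measurable_fun `]c, d]%classic k by exact/measurable_fun_itv_bndo_bndcP.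
have mk : measurable_fun `[c, d]%classic k by exact/measurable_fun_itv_obnd_cbndP.
have intk : (\int[mu]_(t in `[c, d]) (k t)%:E = \int[mu]_(t in `]c, d[) (k t)%:E)%E.
  rewrite -integral_itv_obnd_cbnd; last exact/measurable_EFinP.
  by rewrite -integral_itv_bndo_bndc//; exact/measurable_EFinP.
split; last by rewrite /Rintegral intk -S.
(* Inside, [k] equals its absolute value, so integrability is the finiteness of the integral just
   computed. *)
apply/integrableP; split; first exact/measurable_EFinP.
rewrite -integral_itv_obnd_cbnd; last first.
  by apply: measurableT_comp => //; exact/measurable_EFinP.
rewrite -integral_itv_bndo_bndc//; last first.
  by apply: measurableT_comp => //; exact/measurable_EFinP.
apply: (@le_lt_trans _ _ (\int[mu]_(t in `]c, d[) (k t)%:E)%E); last by rewrite -S ltry.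
rewrite le_eqVlt; apply/orP; left; apply/eqP; apply: eq_integral => t.
rewrite inE/= => tcd; rewrite ger0_norm// kE// mulr_ge0 ?G0//.
by apply/derive_within_incr_ge0/sub; exact: subset_itv_oo_cc.
Qed.

(** [h] is prescribed off [a] only: in the outer integral it is an iterated derivative, known just
    on []a, b]]. For nonzero [nu] the factor [Gamma nu] of the Beta value cancels the
    normalisation. *)
Lemma fracint_left_powR (nu p C x : R) (h : R -> R) :
  0 <= nu -> 0 < p -> 0 <= C -> x \in `]a, b] ->
  (forall t, t \in `]a, x] -> h t = C * (psi t - psi a) `^ (p - 1)) ->
  fracint_left_exists a b nu psi h x /\
  fracint_left a b nu psi h x =
    C * (Gamma p / Gamma (p + nu)) * (psi x - psi a) `^ (p + nu - 1).
Proof.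
move=> nu0 p0 C0; rewrite in_itv/= => /andP[ax xb] hE.
rewrite /fracint_left_exists /fracint_left.
(* Order 0 does occur: for the inner integral when [beta = 1], for the outer one when [beta = 0]. *)
have [->|nun0] := eqVneq nu 0.
  split => //; rewrite addr0 divff ?mulr1; last by rewrite gt_eqF// Gamma_gt0.
  by rewrite hE// in_itv/= ax lexx.
have {}nu0 : 0 < nu by rewrite lt_neqAle eq_sym nun0.
have [|kint ->] := @integral_fracint_kernel a x p nu C
    (fracint_left_kernel a b nu psi h x) (lexx _) ax xb p0 nu0 C0.
  move=> t tax; rewrite /fracint_left_kernel hE; last exact: subset_itv_oo_oc.
  by rewrite -mulrA; congr (_ * _); rewrite mulrCA; congr (_ * _); rewrite mulrC.
split => //; have := Gamma_gt0 nu0; move: (Gamma nu) => g g0.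
have gpn : Gamma (p + nu) != 0 by rewrite gt_eqF// Gamma_gt0// addr_gt0.
by field; rewrite gpn gt_eqF.
Qed.

Lemma fracint_right_powR (nu p C x : R) (h : R -> R) :
  0 <= nu -> 0 < p -> 0 <= C -> x \in `[a, b[ ->
  (forall t, t \in `[x, b[ -> h t = C * (psi b - psi t) `^ (p - 1)) ->
  fracint_right_exists a b nu psi h x /\
  fracint_right a b nu psi h x =
    C * (Gamma p / Gamma (p + nu)) * (psi b - psi x) `^ (p + nu - 1).
Proof.
move=> nu0 p0 C0; rewrite in_itv/= => /andP[ax xb] hE.
rewrite /fracint_right_exists /fracint_right.
have [->|nun0] := eqVneq nu 0.
  split => //; rewrite addr0 divff ?mulr1; last by rewrite gt_eqF// Gamma_gt0.
  by rewrite hE// in_itv/= xb lexx.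
have {}nu0 : 0 < nu by rewrite lt_neqAle eq_sym nun0.
have [|kint ->] := @integral_fracint_kernel x b nu p C
    (fracint_right_kernel a b nu psi h x) ax xb (lexx _) nu0 p0 C0.
  move=> t txb; rewrite /fracint_right_kernel hE; last exact: subset_itv_oo_co.
  by rewrite -mulrA; congr (_ * _); rewrite mulrCA.
split => //; have := Gamma_gt0 nu0; move: (Gamma nu) => g g0; rewrite addrC.
have gpn : Gamma (p + nu) != 0 by rewrite gt_eqF// Gamma_gt0// addr_gt0.
by field; rewrite gpn gt_eqF.
Qed.

End fractional_integral.

Theorem lemma5 (R : realType) (a b : R) (n : nat) (alpha beta delta : R)
    (psi : R -> R)
    (hab : a < b) (hn : (0 < n)%N)
    (halpha : n%:R - 1 < alpha < n%:R)
    (hbeta : 0 <= beta <= 1)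
    (hpsiC : Cn_within `[a, b]%classic n psi)
    (hpsi_incr : {in `[a, b] &, {homo psi : x y / x < y}})
    (hpsi' : forall x : R, x \in `[a, b] ->
       derive_within `[a, b]%classic psi x != 0)
    (hdelta : n%:R < delta) :
  let f := fun x : R => (psi x - psi a) `^ (delta - 1) in
  let g := fun x : R => (psi b - psi x) `^ (delta - 1) in
  (forall x : R, x \in `]a, b] ->
     hilfer_left_exists a b n alpha beta psi f x /\
     hilfer_left a b n alpha beta psi f x =
       Gamma delta / Gamma (delta - alpha) *
       (psi x - psi a) `^ (delta - alpha - 1)) /\
  (forall x : R, x \in `[a, b[ ->
     hilfer_right_exists a b n alpha beta psi g x /\
     hilfer_right a b n alpha beta psi g x =
       Gamma delta / Gamma (delta - alpha) *
       (psi b - psi x) `^ (delta - alpha - 1)).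
Proof.
move=> f g.
have psiD x : x \in `[a, b] -> derivable_within `[a, b]%classic psi x.
  by move=> xab; apply: (hpsiC.1 0%N).
have psiC := hpsiC.2 0%N (leq0n n).
have dpsiC := hpsiC.2 1%N hn.
have psiQ x : x \in `[a, b] ->
    diff_quotient psi x y @[y --> within `[a, b]%classic x^'] -->
      derive_within `[a, b]%classic psi x.
  by move=> xab; apply: derivable_withinP => //; exact: psiD.
set nu := (1 - beta) * (n%:R - alpha); set m := beta * (n%:R - alpha).
have [b0 b1] := andP hbeta; have [a0 a1] := andP halpha.
have nu0 : 0 <= nu by rewrite mulr_ge0// subr_ge0// ltW.
have m0 : 0 <= m by rewrite mulr_ge0// subr_ge0// ltW.
(* The two orders add up to [n - alpha], so the dependence on [beta] disappears. *)
have numE : delta + nu - n%:R + m = delta - alpha by rewrite /nu /m; ring.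
have delta0 : 0 < delta by apply: le_lt_trans hdelta; exact: ler0n.
have c0 : 0 < delta + nu - n%:R by lra.
have nc : n%:R < delta + nu by lra.
have Gc : Gamma (delta + nu) != 0 by rewrite gt_eqF// Gamma_gt0//; lra.
have Gcn : Gamma (delta + nu - n%:R) != 0 by rewrite gt_eqF// Gamma_gt0.
(* [C] and [C'] are the coefficients after the inner integral and after the [n] derivatives. The
   leading 1 is the coefficient of the given power [f] or [g]. *)
pose C := 1 * (Gamma delta / Gamma (delta + nu)).
have C0 : 0 <= C by rewrite /C mul1r divr_ge0// ltW// Gamma_gt0//; lra.
pose C' := C * (Gamma (delta + nu) / Gamma (delta + nu - n%:R)).
have C'0 : 0 <= C'.
  by rewrite /C' mulr_ge0// divr_ge0// ltW// Gamma_gt0//; lra.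
have C'E : C' * (Gamma (delta + nu - n%:R) / Gamma (delta - alpha)) =
    Gamma delta / Gamma (delta - alpha).
  have : Gamma (delta - alpha) != 0 by rewrite gt_eqF// Gamma_gt0//; lra.
  by move=> Gda; rewrite /C' /C; field; rewrite Gda Gcn Gc.
split => x xab.
- have innerE y : y \in `]a, b] -> fracint_left_exists a b nu psi f y /\
      fracint_left a b nu psi f y = C * (psi y - psi a) `^ (delta + nu - 1).
    move=> yab; apply: fracint_left_powR => // t _.
    by rewrite mul1r.
  have subab : `]a, b]%classic `<=` `[a, b]%classic by exact: subset_itv_oc_cc.
  have near_ab y : y \in `]a, b] ->
      \forall z \near within `[a, b]%classic y^', `]a, b]%classic z.
    rewrite in_itv/= => /andP[ay yb].
    apply/(nbhs_ballP y); exists (y - a); first by rewrite /= subr_gt0.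
    move=> z; rewrite /ball/= ltr_norml => /andP[_ h] _; rewrite !in_itv/=.
    by move=> /andP[_ ->]; rewrite andbT; lra.
  have psiaQ y : y \in `]a, b] ->
      diff_quotient (fun t => psi t - psi a) y z
        @[z --> within `[a, b]%classic y^'] --> derive_within `[a, b]%classic psi y.
    move=> yab; have := psiQ y (subab _ yab); apply: cvg_trans.
    apply: near_eq_cvg; apply: nearW => z.
    by rewrite /diff_quotient opprB addrA subrK.
  have pos y : y \in `]a, b] -> 0 < psi y - psi a.
    move=> yab; rewrite subr_gt0; apply: hpsi_incr.
    + by rewrite bound_itvE ltW.
    + exact: subab.
    + by move: yab; rewrite in_itv/= => /andP[].
  have wE y : y \in `]a, b] -> (derive_within `[a, b]%classic psi y)^-1 *
      derive_within `[a, b]%classic psi y = 1.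
    by move=> yab; rewrite mulVf// hpsi'//; exact: subab.
  have Dk := iter_weighted_derive_within_powR hab subab near_ab psiaQ pos wE
    (fun y yab => (innerE y yab).2).
  have subxb : `]a, x]%classic `<=` `]a, b]%classic.
    by apply: subset_itvl; rewrite bnd_simp; move: xab; rewrite in_itv/= => /andP[].
  have [outer_ex outerE] := fracint_left_powR hab hpsi_incr psiD psiC dpsiC
    m0 c0 C'0 xab (fun t txb => (Dk n nc).1 t (subxb _ txb)).
  split; last by rewrite /hilfer_left outerE numE C'E.
  split => //.
  + by move=> y yab; exact: (innerE y yab).1.
  + move=> k y kn yab; apply: (Dk k _).2 => //.
    by apply: lt_trans nc; rewrite ltr_nat.
- have innerE y : y \in `[a, b[ -> fracint_right_exists a b nu psi g y /\
      fracint_right a b nu psi g y = C * (psi b - psi y) `^ (delta + nu - 1).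
    move=> yab; apply: fracint_right_powR => // t _.
    by rewrite mul1r.
  have subab : `[a, b[%classic `<=` `[a, b]%classic by exact: subset_itv_co_cc.
  have near_ab y : y \in `[a, b[ ->
      \forall z \near within `[a, b]%classic y^', `[a, b[%classic z.
    rewrite in_itv/= => /andP[ay yb].
    apply/(nbhs_ballP y); exists (b - y); first by rewrite /= subr_gt0.
    move=> z; rewrite /ball/= ltr_norml => /andP[h _] _; rewrite !in_itv/=.
    by move=> /andP[-> _]/=; lra.
  (* [psi b - psi] has derivative [- psi']; this sign meets the one in [psi_diff_right], so that
     [wE] again gives 1. *)
  have psibQ y : y \in `[a, b[ ->
      diff_quotient (fun t => psi b - psi t) y z
        @[z --> within `[a, b]%classic y^'] --> - derive_within `[a, b]%classic psi y.
    move=> yab; have : - diff_quotient psi y z @[z --> within `[a, b]%classic y^'] -->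
        - derive_within `[a, b]%classic psi y.
      by apply: cvgN; exact/psiQ/subab.
    apply: cvg_trans.
    apply: near_eq_cvg; apply: nearW => z.
    by rewrite /diff_quotient /= -mulNr; congr (_ / _); ring.
  have pos y : y \in `[a, b[ -> 0 < psi b - psi y.
    move=> yab; rewrite subr_gt0; apply: hpsi_incr.
    + exact: subab.
    + by rewrite bound_itvE ltW.
    + by move: yab; rewrite in_itv/= => /andP[].
  have wE y : y \in `[a, b[ -> - (derive_within `[a, b]%classic psi y)^-1 *
      - derive_within `[a, b]%classic psi y = 1.
    by move=> yab; rewrite mulrNN mulVf// hpsi'//; exact: subab.
  have Dk := iter_weighted_derive_within_powR hab subab near_ab psibQ pos wE
    (fun y yab => (innerE y yab).2).
  have subxb : `[x, b[%classic `<=` `[a, b[%classic.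
    by apply: subset_itvr; rewrite bnd_simp; move: xab; rewrite in_itv/= => /andP[].
  have [outer_ex outerE] := fracint_right_powR hab hpsi_incr psiD psiC dpsiC
    m0 c0 C'0 xab (fun t txb => (Dk n nc).1 t (subxb _ txb)).
  split; last by rewrite /hilfer_right outerE numE C'E.
  split => //.
  + by move=> y yab; exact: (innerE y yab).1.
  + move=> k y kn yab; apply: (Dk k _).2 => //.
    by apply: lt_trans nc; rewrite ltr_nat.
Qed.
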